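(* Let $R=R_{\overline 0}\oplus R_{\overline 1}$ be a supercommutative superring with $R_{\overline 1}\neq 0$ which is a superdomain and a unique factorization superring. Let $\mathcal{J}_R=R\cdot R_{\overline 1}$ be its canonical superideal. Then: (i) $R$ is a local ring with maximal ideal $\mathcal{J}_R$; in particular, $R$ is a superfield. (ii) Every normal and irreducible element of $R$ is nilpotent.
   Context: All rings are unitary with $1\neq 0$, and $2$ is a non-zerodivisor in every ring considered. A superring is a $\mathbb{Z}_2$-graded unitary ring $R=R_{\overline 0}\oplus R_{\overline 1}$. All superrings are supercommutative: $xy=(-1)^{|x||y|}yx$ for all homogeneous $x,y$, where $|x|=0$ if $x\in R_{\overline 0}$ and $|x|=1$ if $x\in R_{\overline 1}$; every element of $R_{\overline 1}$ squares to zero. Superrings are assumed to have non-trivial odd part, $R_{\overline 1}\neq 0$. An ideal $\mathfrak{p}$ of $R$ is prime (resp. maximal) if $R/\mathfrak{p}$ is an integral domain (resp. a field). $R$ is local if it has a unique maximal ideal, equivalently if $R\setminus R^\times$ is an ideal, where $R^\times$ is the group of units. The canonical superideal is $\mathcal{J}_R=R\cdot R_{\overline 1}=R_{\overline 1}^2\oplus R_{\overline 1}$, and the superreduction is the commutative ring $\overline R=R/\mathcal{J}_R$. $R$ is a superdomain if $\overline R$ is an integral domain, and a superfield if $\overline R$ is a field. An element $a\in R$ is normal if $aR=Ra$. A non-unit element is irreducible if it cannot be expressed as the product of two non-unit elements. $a$ is associated to $b$ if there are $u,v\in R^\times$ with $a=ubv$. $R$ is a unique factorization superring (UFSR) if: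 (1) every nonzero non-unit $x\in R$ admits a finite factorization $x=f_1\cdots f_d$ into normal irreducible elements of $R$; and (2) if $x=f_1\cdots f_d=g_1\cdots g_n$ are two such factorizations into normal irreducible elements, then $d=n$ and there is a permutation $\sigma\in\mathbb{S}_n$ such that $f_i$ is associated to $g_{\sigma(i)}$ for all $i=1,\ldots,n$. *)

(* Defs.v *)
From HB Require Import structures.
From mathcomp Require Import all_boot perm all_algebra boolp.

Set Implicit Arguments.
Unset Strict Implicit.
Unset Printing Implicit Defensive.

Import GRing.Theory.
Local Open Scope ring_scope.
Local Open Scope quotient_scope.

(* Two-sided ideals of a possibly noncommutative ring.  The improper ideal is
   allowed; [ring_quotient.idealr] is not used because it requires properness
   and its quotient ring is only available for commutative rings. *)
HB.mixin Record isTwoSidedIdeal (R : nzRingType) (S : R -> bool) := {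
  tsidealMl : forall a : R, {in S, forall u, a * u \in S};
  tsidealMr : forall a : R, {in S, forall u, u * a \in S}
}.

#[short(type="tsideal")]
HB.structure Definition TwoSidedIdeal (R : nzRingType) :=
  {S of GRing.ZmodClosed R S & isTwoSidedIdeal R S}.

(* The ring R / I.  It is a [pzRingType], since it is trivial when I = R.  The
   alias hides the ring structure that MathComp puts on [Quotient.quot] for
   commutative rings; the additive structure is MathComp's. *)
Definition ring_quot (R : nzRingType) (I : tsideal R) : Type := Quotient.quot I.

Section RingQuot.
Variables (R : nzRingType) (I : tsideal R).
Local Notation Q := (ring_quot I).

HB.instance Definition _ := GRing.Zmodule.on Q.
HB.instance Definition _ := EqQuotient.on Q.
HB.instance Definition _ :=
  isZmodQuotient.Build R (Quotient.equiv I) 0 -%R +%R Q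
    (@pi_zeror _ _ _ _ _ (Quotient.quot I))
    (@pi_oppr _ _ _ _ _ (Quotient.quot I))
    (@pi_addr _ _ _ _ _ (Quotient.quot I)).

Definition ring_quot_one : Q := lift_cst Q 1.
Definition ring_quot_mul : Q -> Q -> Q := lift_op2 Q *%R.

Canonical pi_ring_quot_one_morph := PiConst ring_quot_one.

Lemma pi_ring_quot_mul : {morph \pi_Q : x y / x * y >-> ring_quot_mul x y}.
Proof.
move=> x y; unlock ring_quot_mul; apply/eqP; rewrite piE Quotient.equivE.
have piB z : z - repr (\pi_Q z) \in I.
  by rewrite Quotient.idealrBE; apply/eqP; rewrite [RHS]reprK.
rewrite -[x * y](addrNK (x * repr (\pi_Q y))) -mulrBr -addrA -mulrBl.
by apply: rpredD; [apply: tsidealMl | apply: tsidealMr]; apply: piB.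
Qed.
Canonical pi_ring_quot_mul_morph := PiMorph2 pi_ring_quot_mul.

Let mulA : associative ring_quot_mul.
Proof. by move=> x y z; rewrite -[x]reprK -[y]reprK -[z]reprK !piE mulrA. Qed.

Let mul1q : left_id ring_quot_one ring_quot_mul.
Proof. by move=> x; rewrite -[x]reprK !piE mul1r. Qed.

Let mulq1 : right_id ring_quot_one ring_quot_mul.
Proof. by move=> x; rewrite -[x]reprK !piE mulr1. Qed.

Let mulDl : left_distributive ring_quot_mul +%R.
Proof.
by move=> x y z; rewrite -[x]reprK -[y]reprK -[z]reprK !piE mulrDl.
Qed.

Let mulDr : right_distributive ring_quot_mul +%R.
Proof.
by move=> x y z; rewrite -[x]reprK -[y]reprK -[z]reprK !piE mulrDr.
Qed.

HB.instance Definition _ :=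
  GRing.Zmodule_isPzRing.Build Q mulA mul1q mulq1 mulDl mulDr.

End RingQuot.

Definition is_integral_domain (Q : pzRingType) : Prop :=
  [/\ (1 : Q) <> 0, commutative (@GRing.mul Q) &
      forall x y : Q, x * y = 0 -> x = 0 \/ y = 0].

Definition is_field (Q : pzRingType) : Prop :=
  [/\ (1 : Q) <> 0, commutative (@GRing.mul Q) &
      forall x : Q, x <> 0 -> exists y : Q, x * y = 1].

Definition is_maximal_ideal (R : nzRingType) (I : tsideal R) : Prop :=
  is_field (ring_quot I).

Definition is_local_with_maximal_ideal (R : nzRingType)
    (M : tsideal R) : Prop :=
  is_maximal_ideal M /\
  forall I : tsideal R, is_maximal_ideal I -> I =i M.

(* Supercommutative superrings.  Parities in Z/2 are booleans ([false] is even,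
   [true] is odd), so that the sum of parities is [addb] and their product is
   [andb]. *)
HB.mixin Record isSuperring R of GRing.UnitRing R := {
  parity_part : bool -> zmodClosed R;
  parity_part1 : (1 : R) \in parity_part false;
  parity_partM : forall (i j : bool) (x y : R),
    x \in parity_part i -> y \in parity_part j ->
    x * y \in parity_part (i (+) j);
  parity_part_sum : forall x : R, exists x0 x1 : R,
    [/\ x0 \in parity_part false, x1 \in parity_part true & x = x0 + x1];
  parity_part_direct : forall x : R,
    x \in parity_part false -> x \in parity_part true -> x = 0;
  supercommutative : forall (i j : bool) (x y : R),
    x \in parity_part i -> y \in parity_part j ->
    x * y = (-1) ^+ (i && j) * (y * x);
  odd_part_sqr0 : forall x : R, x \in parity_part true -> x * x = 0
}.

#[short(type="superringType")]
HB.structure Definition Superring := {R of GRing.UnitRing R & isSuperring R}.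

Definition odd_part (R : superringType) : zmodClosed R :=
  @parity_part R true.

Section CanonicalSuperideal.
Variable R : superringType.

(* Finite sums of products r * s with r in R and s odd. *)
Definition canonical_superideal (x : R) : bool :=
  `[< exists2 rs : seq (R * R),
        (forall p, p \in rs -> p.2 \in odd_part R) &
        x = \sum_(p <- rs) p.1 * p.2 >].

Let canonical_superidealP x :
  reflect (exists2 rs : seq (R * R),
             (forall p, p \in rs -> p.2 \in odd_part R) &
             x = \sum_(p <- rs) p.1 * p.2)
          (x \in canonical_superideal).
Proof. exact: asboolP. Qed.

Let canonicalD x y : x \in canonical_superideal ->
  y \in canonical_superideal -> x + y \in canonical_superideal.
Proof.
move=> /canonical_superidealP[s hs ->] /canonical_superidealP[t ht ->].
apply/canonical_superidealP; exists (s ++ t); last by rewrite big_cat.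
by move=> p; rewrite mem_cat => /orP[/hs|/ht].
Qed.

Let canonical_gen r s : s \in odd_part R -> r * s \in canonical_superideal.
Proof.
move=> hs; apply/canonical_superidealP; exists [:: (r, s)].
  by move=> p; rewrite inE => /eqP->.
by rewrite big_seq1.
Qed.

Let canonical0 : 0 \in canonical_superideal.
Proof. by rewrite -[0](mul0r 0) canonical_gen // rpred0. Qed.

Let canonicalMl (a : R) :
  {in canonical_superideal, forall u, a * u \in canonical_superideal}.
Proof.
move=> u /canonical_superidealP[s hs ->]; rewrite mulr_sumr big_seq.
apply: (big_ind (fun z => z \in canonical_superideal)
  canonical0 canonicalD) => p /hs hp.
by rewrite mulrA canonical_gen.
Qed.

Let canonicalMr (a : R) :
  {in canonical_superideal, forall u, u * a \in canonical_superideal}.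
Proof.
move=> u /canonical_superidealP[s hs ->]; rewrite mulr_suml big_seq.
apply: (big_ind (fun z => z \in canonical_superideal)
  canonical0 canonicalD) => p /hs hp.
have [a0 [a1 [h0 h1 ->]]] := parity_part_sum a.
rewrite -mulrA mulrDr (@supercommutative R true false p.2 a0 hp h0).
rewrite (@supercommutative R true true p.2 a1 hp h1) mulrDr.
by apply: canonicalD; rewrite !mulrA canonical_gen.
Qed.

Let canonical_zmod : zmod_closed canonical_superideal.
Proof.
split=> // x y hx hy; apply: canonicalD => //.
by rewrite -mulN1r canonicalMl.
Qed.

HB.instance Definition _ :=
  GRing.isZmodClosed.Build R canonical_superideal canonical_zmod.
HB.instance Definition _ :=
  isTwoSidedIdeal.Build R canonical_superideal canonicalMl canonicalMr.

End CanonicalSuperideal.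

Definition canonical_ideal (R : superringType) : tsideal R :=
  TwoSidedIdeal.clone R (@canonical_superideal R) _.

Definition superreduction (R : superringType) : pzRingType :=
  ring_quot (canonical_ideal R).

Definition is_superdomain (R : superringType) : Prop :=
  is_integral_domain (superreduction R).

Definition is_superfield (R : superringType) : Prop :=
  is_field (superreduction R).

Section Factorization.
Variable R : unitRingType.

(* a R = R a *)
Definition is_normal (a : R) : Prop :=
  forall x : R, (exists y, x = a * y) <-> (exists y, x = y * a).

Definition is_irreducible (a : R) : Prop :=
  a \isn't a GRing.unit /\
  ~ exists b c : R,
      [/\ b \isn't a GRing.unit, c \isn't a GRing.unit & a = b * c].

Definition is_associated (a b : R) : Prop :=
  exists u v : R,
    [/\ u \is a GRing.unit, v \is a GRing.unit & a = u * b * v].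

Definition normal_factorization (x : R) (f : seq R) : Prop :=
  (forall a, a \in f -> is_normal a /\ is_irreducible a) /\
  x = \prod_(a <- f) a.

(* As in the existence clause, x ranges over the nonzero non-units in the
   uniqueness clause: 0 never has an essentially unique factorization as soon
   as it is a product of normal irreducible elements. *)
Definition is_UFSR : Prop :=
  (forall x : R, x != 0 -> x \isn't a GRing.unit ->
     exists f : seq R, normal_factorization x f) /\
  (forall (x : R) (f g : seq R), x != 0 -> x \isn't a GRing.unit ->
     normal_factorization x f -> normal_factorization x g ->
     size f = size g /\
     exists s : 'S_(size f),
       forall i : 'I_(size f), is_associated f`_i g`_(s i)).

End Factorization.

Definition is_nilpotent (R : nzRingType) (a : R) : Prop :=
  exists n : nat, a ^+ n = 0.

(* Main.v *)
Require Import Defs.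
From mathcomp Require Import all_boot perm all_algebra.
From mathcomp Require Import boolp.

(** Write [J] for the canonical superideal.  It consists of nilpotent elements
    ([canonical_nilpotent]), so units can be recognized modulo [J], and it is
    prime because [R] is a superdomain.  Everything follows from the claim that
    a normal irreducible element [a] always lies in [J]
    ([normal_irreducible_canonical]): this is (ii), and a nonzero non-unit,
    being a nonempty product of such elements, then lies in [J] as well, so that
    the complement of [J] consists of units ([notin_canonical_unit]) and [R / J]
    is a field.  Any maximal ideal contains [J], whose elements are nilpotent,
    and no unit, so it is [J]; this is (i).

    To prove the claim, suppose that [a] is not in [J].  A nonzero odd element
    is a nonzero element of [J], so by primality it has a normal irreducible
    factor [f] in [J].  Let [z = f ^+ n] be the last nonzero power of [f].
    Perturbing [a] inside [J] can be invisible after multiplication: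
    - if [z * a != 0], then [z * (a + f) = z * a] since [z * f = 0];
    - if [z * a = 0], then [(a + z) * a = a * a].
    In either case unique factorization, together with the fact that factors in
    [J] are never associated to factors outside [J], forces the perturbed
    element to be associated to [a] ([perturbation_associated]); as [a] is
    normal, it divides the perturbation, which is a nonzero power of [f].  But
    such a power has a factorization into copies of [f] only, none of which is
    associated to [a] ([power_not_multiple]). *)

Set Implicit Arguments.
Unset Strict Implicit.
Unset Printing Implicit Defensive.

Import GRing.Theory.
Local Open Scope ring_scope.
Local Open Scope quotient_scope.

(** * Ideals and quotients *)

Lemma pi_ring_quot_eq0 (R : nzRingType) (I : tsideal R) (x : R) :
  (\pi_(ring_quot I) x = 0) <-> (x \in I).
Proof.
have -> : (0 : ring_quot I) = \pi_(ring_quot I) 0 by rewrite piE.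
rewrite -[x in x \in I]subr0 Quotient.idealrBE.
by split=> [/eqP|H]; last apply/eqP.
Qed.

Lemma pi_ring_quotM (R : nzRingType) (I : tsideal R) (x y : R) :
  \pi_(ring_quot I) (x * y) = \pi_(ring_quot I) x * \pi_(ring_quot I) y.
Proof. exact: pi_ring_quot_mul. Qed.

Lemma pi_ring_quot1 (R : nzRingType) (I : tsideal R) :
  \pi_(ring_quot I) (1 : R) = 1.
Proof. by rewrite [RHS]piE. Qed.

Lemma integral_quot_prime (R : nzRingType) (I : tsideal R) (x y : R) :
  is_integral_domain (ring_quot I) ->
  (x * y \in I) = (x \in I) || (y \in I).
Proof.
case=> _ _ dom; apply/idP/orP => [|[xI|yI]].
- move/pi_ring_quot_eq0; rewrite pi_ring_quotM.
  by case/dom=> /pi_ring_quot_eq0; [left | right].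
- exact: tsidealMr.
- exact: tsidealMl.
Qed.

Lemma one_notin_ideal (R : nzRingType) (I : tsideal R) :
  (1 : ring_quot I) <> 0 -> 1 \notin I.
Proof. by move=> n1; apply/negP=> /pi_ring_quot_eq0; rewrite pi_ring_quot1. Qed.

Lemma field_integral_domain (Q : pzRingType) :
  is_field Q -> is_integral_domain Q.
Proof.
case=> n1 QC Qinv; split=> // x y xy0.
have [->|/eqP x0] := eqVneq x 0; [by left | right].
have [x' xx'] := Qinv x x0.
by rewrite -[y]mul1r -xx' (QC x) -mulrA xy0 mulr0.
Qed.

Lemma unit_notin_ideal (R : unitRingType) (I : tsideal R) (x : R) :
  1 \notin I -> x \in I -> x \isn't a GRing.unit.
Proof.
move=> n1 xI; apply/negP=> Ux; case/negP: n1.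
by rewrite -(mulVr Ux); apply: tsidealMl.
Qed.

Lemma nilpotent_in_prime (R : nzRingType) (I : tsideal R) (x : R) :
  is_integral_domain (ring_quot I) -> is_nilpotent x -> x \in I.
Proof.
move=> dom [n xn0]; have n1 : 1 \notin I by apply: one_notin_ideal; case: dom.
have : x ^+ n \in I by rewrite xn0 rpred0.
elim: n {xn0} => [|n IHn]; first by rewrite expr0 (negPf n1).
by rewrite exprS (integral_quot_prime _ _ dom) => /orP[|/IHn].
Qed.

Lemma prod_in_prime (R : nzRingType) (I : tsideal R) (s : seq R) :
  is_integral_domain (ring_quot I) ->
  (\prod_(x <- s) x \in I) = has (fun x => x \in I) s.
Proof.
move=> dom; elim: s => [|x s IHs] /=.
  by rewrite big_nil; apply/negbTE/one_notin_ideal; case: dom.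
by rewrite big_cons (integral_quot_prime _ _ dom) IHs.
Qed.

(** * Nilpotency of the canonical superideal *)

Lemma unit_sub1_nilpotent (R : unitRingType) (x : R) :
  is_nilpotent x -> 1 - x \is a GRing.unit.
Proof.
case=> n xn0.
have : (1 - x) * \sum_(i < n) x ^+ i = 1.
  by rewrite -[1 - x]opprB mulNr -subrX1 xn0 sub0r opprK.
have cx : GRing.comm (1 - x) (\sum_(i < n) x ^+ i).
  apply: commr_sum => i _; apply: commr_sym; apply: commrB.
    exact: commr1.
  by apply: commr_sym; apply: commrX.
move/(congr1 (fun y => y \is a GRing.unit)); rewrite unitr1 unitrM_comm //.
by case/andP.
Qed.

Section CanonicalNilpotent.
Variable R : superringType.
Local Notation J := (canonical_ideal R).

Lemma odd_in_canonical (s : R) : s \in odd_part R -> s \in J.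
Proof.
move=> s1; apply/asboolP; exists [:: (1, s)]; last by rewrite big_seq1 mul1r.
by move=> p; rewrite inE => /eqP->.
Qed.

(** Multiplication by an odd [s] from the left can be moved to the right at the
    cost of the parity automorphism [r0 + r1 |-> r0 - r1]. *)
Lemma odd_mulC (s r : R) : s \in odd_part R -> exists r', s * r = r' * s.
Proof.
move=> s1; have [r0 [r1 [h0 h1 ->]]] := parity_part_sum r.
exists (r0 - r1); rewrite mulrDr mulrBl.
rewrite (@supercommutative R true false s r0 s1 h0).
by rewrite (@supercommutative R true true s r1 s1 h1) expr0 expr1 mul1r mulN1r.
Qed.

(** Modulo the ideal [R s], which has square zero, adding a multiple of [s] does
    not change powers. *)
Lemma nilpotent_add_odd_multiple (y r s : R) : s \in odd_part R ->
  is_nilpotent y -> is_nilpotent (y + r * s).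
Proof.
move=> s1 [k yk0].
have [c ec] : exists c, (y + r * s) ^+ k = y ^+ k + c * s.
  elim: k {yk0} => [|k [c IHk]]; first by exists 0; rewrite !expr0 mul0r addr0.
  have [t et] := odd_mulC (y ^+ k + c * s) s1.
  exists (y * c + r * t).
  by rewrite exprS IHk mulrDl -[r * s * _]mulrA et mulrDr -exprS mulrDl
             !mulrA addrA.
have [t et] := odd_mulC c s1.
(* [c * s] squares to zero: moving the first [s] past [c] produces [s * s]. *)
exists (k + k)%N; rewrite exprD ec yk0 add0r.
by rewrite mulrA -(mulrA c s c) et -!mulrA odd_part_sqr0 // !mulr0.
Qed.

Lemma canonical_nilpotent (x : R) : x \in J -> is_nilpotent x.
Proof.
case/asboolP=> rs; elim: rs x => [|[r s] rs IH] x hrs ->.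
  by exists 1%N; rewrite big_nil expr1.
rewrite big_cons addrC /=.
apply: nilpotent_add_odd_multiple.
  by apply: (hrs (r, s)); rewrite inE eqxx.
by apply: IH => // p prs; apply: hrs; rewrite inE prs orbT.
Qed.

(** When [u] is a unit, [u + z = u * (1 - (- u^-1 * z))], where [- u^-1 * z] is
    nilpotent; the converse follows by subtracting [z]. *)
Lemma unit_add_canonical (u z : R) :
  z \in J -> (u + z \is a GRing.unit) = (u \is a GRing.unit).
Proof.
suff imp v y : y \in J -> v \is a GRing.unit -> v + y \is a GRing.unit.
  move=> zJ; apply/idP/idP => [|/(imp _ _ zJ)] // /imp - /(_ (- z)).
  by rewrite rpredN addrK => /(_ zJ).
move=> yJ Uv.
have -> : v + y = v * (1 - (- v^-1 * y)).
  by rewrite mulNr opprK mulrDr mulr1 mulVKr.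
rewrite unitrMr //; apply: unit_sub1_nilpotent; apply: canonical_nilpotent.
exact: tsidealMl.
Qed.

End CanonicalNilpotent.

(** * Factorizations *)

Section Factorizations.
Variable R : unitRingType.

Lemma irreducible_neq0 (a : R) : is_irreducible a -> a != 0.
Proof.
case=> Na irr; apply/eqP=> a0; apply: irr; exists a, a; split=> //.
by rewrite a0 mul0r.
Qed.

Lemma normal_factorization_cat (x y : R) (f g : seq R) :
  normal_factorization x f -> normal_factorization y g ->
  normal_factorization (x * y) (f ++ g).
Proof.
move=> [hf ->] [hg ->]; split; last by rewrite big_cat.
by move=> a; rewrite mem_cat => /orP[/hf|/hg].
Qed.

Lemma normal_factorization_seq1 (a : R) :
  is_normal a -> is_irreducible a -> normal_factorization a [:: a].
Proof.
by move=> na ia; split=> [b|]; rewrite ?big_seq1 // inE => /eqP->.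
Qed.

Lemma normal_factorization_nseq (a : R) (n : nat) :
  is_normal a -> is_irreducible a -> normal_factorization (a ^+ n) (nseq n a).
Proof.
move=> na ia; split=> [b /nseqP[-> _] //|].
by rewrite big_nseq -Monoid.iteropE.
Qed.

Lemma UFSR_size (x : R) (f g : seq R) : is_UFSR R ->
  x != 0 -> x \isn't a GRing.unit ->
  normal_factorization x f -> normal_factorization x g -> size f = size g.
Proof. by case=> _ U x0 Nx hf hg; have [] := U x f g x0 Nx hf hg. Qed.

Lemma UFSR_associated_mem (x : R) (f g : seq R) (a : R) : is_UFSR R ->
  x != 0 -> x \isn't a GRing.unit ->
  normal_factorization x f -> normal_factorization x g ->
  a \in f -> exists2 b, b \in g & is_associated a b.
Proof.
case=> _ U x0 Nx hf hg af; have [sfg [s hs]] := U x f g x0 Nx hf hg.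
have lt_a : (index a f < size f)%N by rewrite index_mem.
exists g`_(s (Ordinal lt_a)); first by rewrite mem_nth // -sfg.
by have := hs (Ordinal lt_a); rewrite /= nth_index.
Qed.

Lemma normal_associated_multiple (a b : R) :
  is_normal a -> is_associated b a -> exists w, b = a * w.
Proof.
move=> na [u [v [_ _ ->]]].
have [|w ->] := (na (u * a)).2; first by exists u.
by exists (w * v); rewrite mulrA.
Qed.

Lemma associated_in_ideal (I : tsideal R) (a b : R) :
  is_associated a b -> b \in I -> a \in I.
Proof. by case=> u [v [_ _ ->]] bI; apply/tsidealMr/tsidealMl. Qed.

End Factorizations.

(** * Normal irreducible elements of a superdomain with unique factorization *)

Section Superdomain.
Variable R : superringType.
Hypotheses (superdomain : is_superdomain R) (ufsr : is_UFSR R).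
Local Notation J := (canonical_ideal R).

Let canonical_prime (x y : R) : (x * y \in J) = (x \in J) || (y \in J).
Proof. exact: integral_quot_prime. Qed.

Let canonical_proper : 1 \notin J.
Proof. by apply: one_notin_ideal; case: superdomain. Qed.

Let canonical_nonunit (x : R) : x \in J -> x \isn't a GRing.unit.
Proof. exact: unit_notin_ideal. Qed.

Let notin_canonical_neq0 (x : R) : x \notin J -> x != 0.
Proof. by apply: contraNneq => ->; rewrite rpred0. Qed.

(** In the two factorizations of the common product, lengths show that [a + z]
    is a single irreducible element, which lies outside [J] as [a] does; the
    only factor on the other side to which it can be associated is [a]. *)
Lemma perturbation_associated (a z : R) (f g : seq R) (x y : R) :
  is_normal a -> is_irreducible a -> a \notin J -> z \in J ->
  normal_factorization x f -> normal_factorization y g ->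
  (forall b, b \in f ++ g -> b \in J \/ b = a) ->
  x * (a + z) * y = x * a * y -> x * a * y != 0 ->
  x * a * y \isn't a GRing.unit ->
  is_associated (a + z) a.
Proof.
move=> na ia aJ zJ hf hg hfg e xay0 Nxay.
have azJ : a + z \notin J by rewrite rpredDr.
have Naz : a + z \isn't a GRing.unit by rewrite unit_add_canonical //; case: ia.
have [h hh] := ufsr.1 _ (notin_canonical_neq0 azJ) Naz.
have h1 := normal_factorization_cat (normal_factorization_cat hf hh) hg.
have h2 := normal_factorization_cat
  (normal_factorization_cat hf (normal_factorization_seq1 na ia)) hg.
rewrite e in h1; have /eqP := UFSR_size ufsr xay0 Nxay h1 h2.
rewrite !size_cat eqn_add2r eqn_add2l.
case: h hh h1 => [|b [|//]] // [_]; rewrite big_seq1 => eb h1 _.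
have [|c cfg bc] := UFSR_associated_mem (a := b) ufsr xay0 Nxay h1 h2.
  by rewrite !mem_cat inE eqxx orbT.
rewrite eb; suff [cJ | <- //] : c \in J \/ c = a.
  by case/negP: azJ; rewrite eb; apply: associated_in_ideal bc cJ.
move: cfg; rewrite !mem_cat inE -orbA => /or3P[cf|/eqP->|cg].
- by apply: hfg; rewrite mem_cat cf.
- by right.
- by apply: hfg; rewrite mem_cat cg orbT.
Qed.

(** A cofactor of [a] in [f ^+ n] is a nonzero element of [J], hence it factors;
    this would exhibit [a] in a factorization of [f ^+ n]. *)
Lemma power_not_multiple (a f c : R) (n : nat) :
  is_normal a -> is_irreducible a -> a \notin J ->
  is_normal f -> is_irreducible f -> f \in J ->
  (0 < n)%N -> f ^+ n != 0 -> f ^+ n <> a * c.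
Proof.
move=> na ia aJ nf irf fJ n_gt0 fn0 e.
have fnJ : f ^+ n \in J.
  by case: n n_gt0 {fn0 e} => // n _; rewrite exprS; apply: tsidealMr.
have cJ : c \in J by move: fnJ; rewrite e canonical_prime (negPf aJ).
have c0 : c != 0 by apply: contraNneq fn0 => c0; rewrite e c0 mulr0.
have [h hh] := ufsr.1 _ c0 (canonical_nonunit cJ).
have h1 := normal_factorization_cat (normal_factorization_seq1 na ia) hh.
rewrite -e in h1.
have h2 := normal_factorization_nseq n nf irf.
have [|b /nseqP[-> _] af] := UFSR_associated_mem (a := a) ufsr fn0
  (canonical_nonunit fnJ) h1 h2; first by rewrite inE eqxx.
by case/negP: aJ; apply: associated_in_ideal af fJ.
Qed.

Lemma exists_normal_irreducible_canonical :
  (exists2 x : R, x \in odd_part R & x != 0) ->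
  exists f : R, [/\ is_normal f, is_irreducible f & f \in J].
Proof.
case=> s /odd_in_canonical sJ s0.
have [h [hh es]] := ufsr.1 _ s0 (canonical_nonunit sJ).
move: sJ; rewrite es (prod_in_prime _ superdomain) => /hasP[f fh fJ].
by have [nf irf] := hh f fh; exists f.
Qed.

Lemma normal_irreducible_canonical (a : R) :
  (exists2 x : R, x \in odd_part R & x != 0) ->
  is_normal a -> is_irreducible a -> a \in J.
Proof.
move=> /exists_normal_irreducible_canonical[f [nf irf fJ]] na ia.
apply/negP => /negP aJ.
have [n [n_gt0 fn0 fSn0]] : exists n, [/\ (0 < n)%N, f ^+ n != 0 & f ^+ n.+1 = 0].
  have exn : exists n, f ^+ n == 0.
    by have [n /eqP] := canonical_nilpotent fJ; exists n.
  case: (ex_minnP exn) => -[|[|n]] /eqP fn0 min_n.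
  - by have /eqP := oner_neq0 R; rewrite -fn0 expr0.
  - by have := irreducible_neq0 irf; rewrite -[f]expr1 fn0 eqxx.
  - by exists n.+1; split=> //; apply/negP=> /min_n; rewrite ltnn.
have fnJ : f ^+ n \in J.
  by case: n n_gt0 {fn0 fSn0} => // n _; rewrite exprS; apply: tsidealMr.
suff [m [m_gt0 fm0 aff]] : exists m, [/\ (0 < m)%N, f ^+ m != 0 &
    is_associated (a + f ^+ m) a].
  have [w ew] := normal_associated_multiple na aff.
  apply: (power_not_multiple (c := w - 1) na ia aJ nf irf fJ m_gt0 fm0).
  by rewrite mulrBr mulr1 -ew addrC addKr.
have hn := normal_factorization_nseq n nf irf.
have hnil : normal_factorization (1 : R) [::] by split; rewrite ?big_nil.
have [fna0 | fna0] := eqVneq (f ^+ n * a) 0.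
- exists n; split=> //; have aaJ : a * a \notin J.
    by rewrite canonical_prime negb_or aJ.
  apply: (perturbation_associated na ia aJ fnJ hnil
    (normal_factorization_seq1 na ia)); rewrite ?mul1r.
  + by move=> b; rewrite inE => /eqP; right.
  + by rewrite mulrDl fna0 addr0.
  + exact: notin_canonical_neq0.
  + by rewrite -expr2 unitrX_pos //; case: ia.
- exists 1%N; rewrite expr1; split=> //; first exact: irreducible_neq0.
  apply: (perturbation_associated na ia aJ fJ hn hnil); rewrite ?mulr1 //.
  + by move=> b; rewrite cats0 => /nseqP[-> _]; left.
  + by rewrite mulrDr -exprSr fSn0 addr0.
  + by apply: canonical_nonunit; apply: tsidealMr.
Qed.

Lemma notin_canonical_unit (x : R) :
  (exists2 y : R, y \in odd_part R & y != 0) ->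
  x \notin J -> x \is a GRing.unit.
Proof.
move=> hodd xJ; apply/negPn/negP=> Nx.
have [h [hh ex]] := ufsr.1 _ (notin_canonical_neq0 xJ) Nx.
case: h hh ex => [|a h] hh ex; first by rewrite ex big_nil unitr1 in Nx.
have [na ia] := hh a (mem_head _ _).
case/negP: xJ; rewrite ex big_cons; apply: tsidealMr.
exact: normal_irreducible_canonical.
Qed.

Lemma superdomain_UFSR_superfield :
  (exists2 y : R, y \in odd_part R & y != 0) -> is_superfield R.
Proof.
move=> hodd; have [n1 QC _] := superdomain; split=> // q.
rewrite -[q]reprK => q0; exists (\pi_(superreduction R) (repr q)^-1).
rewrite -pi_ring_quotM mulrV ?pi_ring_quot1 //.
by apply: notin_canonical_unit => //; apply/negP => /pi_ring_quot_eq0.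
Qed.

End Superdomain.

Theorem theorem3p11 (R : superringType)
    (two_regular : forall x : R, x *+ 2 = 0 -> x = 0)
    (odd_nontrivial : exists2 x : R, x \in odd_part R & x != 0)
    (superdomain : is_superdomain R)
    (ufsr : is_UFSR R) :
  (is_local_with_maximal_ideal (canonical_ideal R) /\ is_superfield R) /\
  (forall a : R, is_normal a -> is_irreducible a -> is_nilpotent a).
Proof.
have sf := superdomain_UFSR_superfield superdomain ufsr odd_nontrivial.
split; last first.
  by move=> a na ia; apply/canonical_nilpotent/normal_irreducible_canonical.
split=> //; split=> // I fI x.
have dI := field_integral_domain fI; apply/idP/idP => [xI|xJ].
- apply: contraLR xI => xJ.
  have Ux := notin_canonical_unit superdomain ufsr odd_nontrivial xJ.
  apply: contraL Ux; apply: unit_notin_ideal.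
  by apply: one_notin_ideal; case: fI.
- by apply: nilpotent_in_prime => //; apply: canonical_nilpotent.
Qed.
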